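(* Let $\kappa$ be a regular uncountable cardinal and $\lambda>\kappa$ a cardinal. Suppose that $\kappa$ is a limit cardinal and $H$ is an ideal on $P_\kappa(\lambda)$ such that $\mathrm{cof}(H)<\mathbf{cov}(\mathbf{M}_{\kappa,\kappa})$. Then $H^+\xrightarrow{\kappa}[H^+]^2_{\kappa^+}$.
   Context: For a cardinal $\mu$ and a set $A$, $P_\mu(A)=\{a\subseteq A:|a|<\mu\}$. An ideal on an infinite set $S$ is a collection $K$ of subsets of $S$ containing all singletons, closed under subsets and finite unions, with $S\notin K$; $K^+=P(S)\setminus K$; $\mathrm{cof}(K)$ is the least cardinality of an $X\subseteq K$ with $K=\bigcup_{A\in X}P(A)$. $I_{\kappa,\lambda}$ is the set of all $A\subseteq P_\kappa(\lambda)$ such that $A\cap\{b\in P_\kappa(\lambda):a\subseteq b\}=\emptyset$ for some $a\in P_\kappa(\lambda)$. ''Ideal on $P_\kappa(\lambda)$'' always means an ideal $H$ on $P_\kappa(\lambda)$ that is $\kappa$-complete (closed under unions of fewer than $\kappa$ members) and fine ($I_{\kappa,\lambda}\subseteq H$). For $A\subseteq P_\kappa(\lambda)$, $[A]^2_\kappa=\{(\bigcup(a\cap\kappa),b):a,b\in A,\ \bigcup(a\cap\kappa)<\bigcup(b\cap\kappa)\}$. For a cardinal $\rho$ with $2\le\rho\le\lambda^{<\kappa}$ and an ideal $H$ on $P_\kappa(\lambda)$, $H^+\xrightarrow{\kappa}[H^+]^2_\rho$ means: for every $F:[P_\kappa(\lambda)]^2_\kappa\to\rho$ and every $A\in H^+$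 there is $B\in H^+\cap P(A)$ such that $F''[B]^2_\kappa\ne\rho$. $\mathbf{cov}(\mathbf{M}_{\kappa,\kappa})$: give ${}^\kappa2$ the topology whose basic open sets are $\emptyset$ and $O_s=\{f\in{}^\kappa2:s\subseteq f\}$ for $s\in\bigcup\{{}^a2:a\in P_\kappa(\kappa)\}$. $\mathbf{M}_{\kappa,\kappa}$ is the set of all $W\subseteq{}^\kappa2$ such that $W\cap\bigcap X=\emptyset$ for some collection $X$ of dense open sets with $0<|X|\le\kappa$. $\mathbf{cov}(\mathbf{M}_{\kappa,\kappa})$ is the least cardinality of a $Y\subseteq\mathbf{M}_{\kappa,\kappa}$ with $\bigcup Y={}^\kappa2$. *)

(* Defs.v *)
From mathcomp Require Import all_boot all_order.
From mathcomp Require Import boolp classical_sets functions cardinality.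

Set Implicit Arguments.
Unset Strict Implicit.
Unset Printing Implicit Defensive.

Import Order.TTheory.
Local Open Scope order_scope.
Local Open Scope classical_set_scope.
Local Open Scope card_scope.

Reserved Notation "A '#<' B" (at level 79, format "A  '#<'  B").
Notation "A '#<' B" := ((A #<= B) && (A #!= B)) : card_scope.

(* Cardinals are well-ordered: this makes "least cardinality" meaningful. *)
Lemma card_min (I T : Type) (i0 : I) (F : I -> set T) :
  exists i, forall j, F i #<= F j.
Proof.
(* A maximal family [S] of selectors that is injective in each coordinate
   exhausts some [F i], and hence injects that [F i] into every other [F j]. *)
pose ok (S : set (I -> T)) := (forall f, S f -> forall i, F i (f i)) /\
  (forall f g i, S f -> S g -> f i = g i -> f = g).
have [|S [[SF Sinj] Smax]] := @Zorn_bigcup (I -> T) ok.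
  move=> C Cok Ctot; split=> [f [X CX Xf]|f g i [X CX Xf] [Y CY Yg]].
    by have [+ _] := Cok _ CX; apply.
  have [XY|YX] := Ctot _ _ CX CY.
    by have [_ +] := Cok _ CY; apply; [exact: XY|].
  by have [_ +] := Cok _ CX; apply; [|exact: YX].
have [i FiS] : exists i, F i `<=` (fun f => f i) @` S.
  apply: contrapT => noi.
  have /choice[f fP] : forall i, exists x, F i x /\ ~ ((fun f => f i) @` S) x.
    move=> i; apply: contrapT => nox; apply: noi; exists i => x Fx.
    by apply: contrapT => nSx; apply: nox; exists x.
  apply: (Smax (S `|` [set f])).
    rewrite properEneq; split; last exact: subsetUl.
    apply/eqP => SU; have [_] := fP i0; apply; exists f => //.
    by rewrite SU; right.
  split=> [g [Sg|->] j|g h j [Sg|->] [Sh|->]] //.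
  - exact: SF.
  - by have [] := fP j.
  - exact: Sinj.
  - by move=> gf; have [_ []] := fP j; exists g.
  - by move=> fh; have [_ []] := fP j; exists h.
exists i => j; apply: (card_le_trans (subset_card_le FiS)).
apply: (card_le_trans (card_image_le _ _)).
have inj : {in S &, injective (fun f : I -> T => f j)}.
  by move=> f g /set_mem Sf /set_mem Sg; exact: Sinj.
rewrite -(card_le_eql (inj_card_eq inj)); apply: subset_card_le.
by move=> _ [f Sf <-]; exact: SF.
Qed.

(* The least cardinality of a member of [P], represented by a member that
   attains it. *)
Definition min_card (T : Type) (P : set (set T)) : set T :=
  xget set0 [set A | P A /\ forall B, P B -> A #<= B].

Lemma min_cardP (T : Type) (P : set (set T)) : P !=set0 ->
  P (min_card P) /\ forall B, P B -> min_card P #<= B.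
Proof.
case=> A0 PA0.
have [[A PA] Amin] := @card_min {A | P A} T (exist _ A0 PA0) (fun A => sval A).
have Ale : forall B, P B -> A #<= B by move=> B PB; exact: (Amin (exist _ B PB)).
by apply: (@xgetI _ _ [set A | P A /\ forall B, P B -> A #<= B]); split; [exact: PA|].
Qed.

Definition is_ideal (T : Type) (S : set T) (K : set (set T)) :=
  [/\ K `<=` [set A | A `<=` S],
      forall x, S x -> K [set x],
      forall A B, K A -> B `<=` A -> K B,
      forall A B, K A -> K B -> K (A `|` B) &
      ~ K S].

(* K^+ for an ideal K on S *)
Definition positive (T : Type) (S : set T) (K : set (set T)) : set (set T) :=
  [set A | A `<=` S /\ ~ K A].

Definition cof (T : Type) (K : set (set T)) : set (set T) :=
  min_card [set X | X `<=` K /\ K = \bigcup_(A in X) [set B | B `<=` A]].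

(* [W] is meant to be well-ordered by [<]: its elements stand for the ordinals
   below some fixed ordinal, each one being identified with the set [below a]
   of its predecessors. Cardinals are initial ordinals. *)
Section PkappaLambda.
Context {d : Order.disp_t} {W : orderType d}.
Implicit Types (mu nu kappa lambda rho : W) (a b : set W) (A B : set (set W)).

Definition below mu : set W := [set x | x < mu].

Definition is_cardinal mu := forall x, x < mu -> below x #< below mu.

Definition is_succ_cardinal mu nu :=
  [/\ is_cardinal nu, mu < nu &
      forall nu', is_cardinal nu' -> mu < nu' -> nu <= nu'].

Definition is_limit_cardinal kappa :=
  is_cardinal kappa /\
  forall mu, is_cardinal mu -> ~ is_succ_cardinal mu kappa.

(* P_mu(X) *)
Definition Psub mu (X : set W) : set (set W) :=
  [set a | a `<=` X /\ a #< below mu].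

Definition is_regular kappa :=
  [/\ is_cardinal kappa, infinite_set (below kappa) &
      forall a, Psub kappa (below kappa) a ->
        exists2 x, x < kappa & forall y, a y -> y < x].

(* I_{kappa,lambda} *)
Definition Ikl kappa lambda : set (set (set W)) :=
  [set A | A `<=` Psub kappa (below lambda) /\
     exists2 a, Psub kappa (below lambda) a &
       A `&` [set b | Psub kappa (below lambda) b /\ a `<=` b] = set0].

Definition is_Pkl_ideal kappa lambda (H : set (set (set W))) :=
  [/\ is_ideal (Psub kappa (below lambda)) H,
      forall X, X `<=` H -> X #< below kappa -> H (\bigcup_(A in X) A) &
      Ikl kappa lambda `<=` H].

(* The union of a set of ordinals is its least upper bound. One exists below,
   as [W] is well-ordered and [kappa] is an upper bound; it is 0 for the empty
   set. *)
Definition ksup kappa a : W := xget kappa (supremums (a `&` below kappa)).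

(* [A]^2_kappa *)
Definition kpairs kappa A : set (W * set W) :=
  [set p | exists a b, [/\ A a, A b, ksup kappa a < ksup kappa b &
                           p = (ksup kappa a, b)]].

(* H^+ -->^kappa [H^+]^2_rho *)
Definition karrow kappa lambda (H : set (set (set W))) rho :=
  forall F : W * set W -> W,
    (forall p, kpairs kappa (Psub kappa (below lambda)) p -> F p < rho) ->
  forall A, positive (Psub kappa (below lambda)) H A ->
  exists B, [/\ positive (Psub kappa (below lambda)) H B, B `<=` A &
                F @` kpairs kappa B <> below rho].

(* ^kappa 2 *)
Definition ktwo kappa : Type := set_type (below kappa) -> bool.

(* O_s for the restriction of [s] to [a]; every partial function on [kappa]
   with domain [a] is of this form. *)
Definition basicO kappa a (s : ktwo kappa) : set (ktwo kappa) :=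
  [set f | forall x, a (val x) -> f x = s x].

Definition basic_open kappa : set (set (ktwo kappa)) :=
  [set O | O = set0 \/
     exists a s, Psub kappa (below kappa) a /\ O = basicO a s].

Definition kopen kappa (U : set (ktwo kappa)) :=
  exists2 C, C `<=` @basic_open kappa & U = \bigcup_(O in C) O.

Definition kdense kappa (D : set (ktwo kappa)) :=
  forall U, kopen U -> U !=set0 -> D `&` U !=set0.

(* M_{kappa,kappa} *)
Definition Mkk kappa : set (set (ktwo kappa)) :=
  [set V | exists X : set (set (ktwo kappa)),
     [/\ forall D, X D -> kopen D /\ kdense D, X !=set0, X #<= below kappa &
         V `&` \bigcap_(D in X) D = set0]].

Definition covM kappa : set (set (ktwo kappa)) :=
  min_card [set Y | Y `<=` @Mkk kappa /\ \bigcup_(V in Y) V = setT].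

End PkappaLambda.

Arguments basic_open {d W} kappa _.
Arguments Mkk {d W} kappa _.
Arguments covM {d W} kappa _.

(* Main.v *)
(* Let F color the pairs and let A be positive. For a bounded c included in
   kappa, fewer than kappa colors g are bad for c, in the sense that the set of
   the b in A with F(x, b) <> g for all x in c belongs to H: otherwise, kappa
   being a limit cardinal, more than |c| but fewer than kappa of them could be
   gathered by kappa-completeness, and a single b in A would give F(-, b) more
   than |c| values on c. By fineness kappa^+ <= cof(H) < cov(M), so kappa has
   only kappa bounded subsets by Landver's theorem, and some g < kappa^+ is bad
   for none of them.
   Fix such a g. For C a subset of kappa let B be the set of the b in A whose
   kappa-supremum s lies in C and such that F(x, b) <> g for all x in C below s:
   then F avoids g on the pairs from B. For each X in a cofinal subset of H, the
   sets C for which B is not included in X form a dense open set, so a C meeting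
   these cof(H) < cov(M) requirements makes B positive. *)

Require Import Defs.
From mathcomp Require Import all_boot all_order.
From mathcomp Require Import boolp classical_sets functions cardinality.

Import Order.TTheory.

Local Open Scope order_scope.
Local Open Scope classical_set_scope.
Local Open Scope card_scope.

Set Implicit Arguments.
Unset Strict Implicit.
Unset Printing Implicit Defensive.

(** * Comparison of cardinalities of arbitrary sets *)

Section Cardinality.

Lemma card_ltP T U (A : set T) (B : set U) :
  A #< B <-> A #<= B /\ ~ (B #<= A).
Proof.
rewrite card_eq_le negb_and; split=> [/andP[AB]|[AB nBA]].
  by rewrite AB /= => /negP.
by rewrite AB /=; apply/negP.
Qed.

Lemma card_le_lt_trans T U V (B : set U) (A : set T) (C : set V) :
  A #<= B -> B #< C -> A #< C.
Proof.
move=> AB /card_ltP[BC nCB]; apply/card_ltP; split.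
  exact: card_le_trans BC.
by move=> CA; apply/nCB/(card_le_trans CA).
Qed.

Lemma card_le_inj T U (A : set T) (B : set U) (f : T -> U) :
  (forall x, A x -> B (f x)) ->
  (forall x y, A x -> A y -> f x = f y -> x = y) -> A #<= B.
Proof.
move=> fAB fI; have fI' : {in A &, injective f}.
  by move=> x y /set_mem Ax /set_mem Ay; exact: fI.
rewrite -(card_le_eql (inj_card_eq fI')); apply: subset_card_le.
by move=> _ [x Ax <-]; exact: fAB.
Qed.

Lemma card_leP_inj T U (u0 : U) (A : set T) (B : set U) : A #<= B ->
  exists f : T -> U, (forall x, A x -> B (f x)) /\
    (forall x y, A x -> A y -> f x = f y -> x = y).
Proof.
move=> /card_leP[f].
exists (fun x => if pselect (A x) is left Ax
                 then val (f (SigSub (mem_set Ax))) else u0).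
split=> [x Ax|x y Ax Ay]; case: pselect => // Ax'.
  exact: set_valP.
case: pselect => // Ay' /val_inj fxy.
suff /(congr1 val) : SigSub (mem_set Ax') = SigSub (mem_set Ay') by [].
by apply: 'inj_f; rewrite ?in_setT.
Qed.

(** Any choice function for [r] is injective on [A]; the relational form lets later arguments leave
    that choice implicit. *)
Lemma card_le_rel T U (A : set T) (B : set U) (r : T -> U -> Prop) :
  (forall x, A x -> exists2 y, B y & r x y) ->
  (forall x x' y, A x -> A x' -> r x y -> r x' y -> x = x') -> A #<= B.
Proof.
move=> rAB rI; have [->//|/set0P[x0 Ax0]] := eqVneq A set0.
have [y0 _ _] := rAB _ Ax0.
have /choice[f fP] : forall x, exists y, A x -> B y /\ r x y.
  move=> x; have [/rAB[y By rxy]|nAx] := pselect (A x); first by exists y.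
  by exists y0.
apply: (@card_le_inj _ _ _ _ f) => [x /fP[]//|x y Ax Ay fxy].
by have [[_ rx] [_ ry]] := (fP _ Ax, fP _ Ay); apply: rI rx _; rewrite ?fxy.
Qed.

(* An injection [A -> B] is built by well-founded recursion, each element being
   sent to a member of [B] not yet taken by its predecessors. *)
Lemma wf_card_le T U (R : T -> T -> Prop) (A : set T) (B : set U) :
  well_founded R ->
  (forall x y, A x -> A y -> [\/ x = y, R x y | R y x]) ->
  (forall x, A x -> ~ (B #<= [set y | A y /\ R y x])) -> A #<= B.
Proof.
move=> Rwf Rtot nB; have [->//|/set0P[x0 Ax0]] := eqVneq A set0.
have [B0|/set0P[y0 By0]] := eqVneq B set0.
  by case: (nB _ Ax0); rewrite B0.
pose new x (rec : forall y, R y x -> U) u :=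
  B u /\ forall y (Ryx : R y x), A y -> rec y Ryx <> u.
pose step x rec : U :=
  if pselect (exists u, @new x rec u) is left h then sval (cid h) else y0.
pose f := Fix Rwf (fun=> U) step.
have fE x : f x = step x (fun y _ => f y).
  apply: Fix_eq => {}x g h gh; congr step.
  by apply: functional_extensionality_dep => y; apply/funext => r; exact: gh.
have fP x : A x -> B (f x) /\ forall y, R y x -> A y -> f y <> f x.
  move=> Ax; rewrite fE /step; case: pselect => [h|noh].
    by case: (svalP (cid h)).
  exfalso; apply: (nB _ Ax).
  apply: (@card_le_trans _ _ _ (f @` [set y | A y /\ R y x])).
    apply: subset_card_le => u Bu; apply: contrapT => nu; apply: noh.
    exists u; split=> // y Ryx Ay fyu; apply: nu; by exists y.
  exact: card_image_le.
apply: (@card_le_inj _ _ _ _ f) => [x /fP[]//|x y Ax Ay fxy].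
have [//|Rxy|Ryx] := Rtot _ _ Ax Ay.
- by have [_ /(_ _ Rxy Ax)] := fP _ Ay.
- by have [_ /(_ _ Ryx Ay)] := fP _ Ax; rewrite fxy.
Qed.

(** Hilbert's hotel: [x] takes the place of [f 0], each [f n] moves to [f n.+1], and the other
    points stay. *)
Lemma infinite_setU1_card T (A : set T) (x : T) :
  infinite_set A -> A `|` [set x] #<= A.
Proof.
have [Ax infA|nAx /infiniteP] := pselect (A x).
  by apply: subset_card_le => y [//|->].
move=> /(card_leP_inj x)[f [fA fI]].
pose r y z := [\/ y = x /\ z = f 0%N, exists2 n, y = f n & z = f n.+1 |
  [/\ z = y, y <> x & ~ (range f) y]].
apply: (@card_le_rel _ _ _ _ r) => [y [Ay|->]|y y' z _ _].
- have [[n _ <-]|nfy] := pselect (range f y).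
    by exists (f n.+1); [exact: fA|constructor 2; exists n].
  by exists y => //; constructor 3; split=> // yx; apply: nAx; rewrite -yx.
- by exists (f 0%N); [exact: fA|constructor 1].
have fI' m n : f m = f n -> m = n by exact: fI.
move=> [[-> ->]|[n -> ->]|[-> yx nfy]] [[-> e]|[m -> e]|[e yx' nfy']] //.
- by have := fI' _ _ e.
- by case: nfy'; rewrite -e; exists 0%N.
- by have := fI' _ _ e.
- by have [->] := fI' _ _ e.
- by case: nfy'; rewrite -e; exists n.+1.
- by case: nfy; rewrite e; exists 0%N.
- by case: nfy; rewrite e; exists m.+1.
Qed.

End Cardinality.

(** * Ordinals, cardinal arithmetic and generic subsets of [kappa] *)

Section Ordinals.
Context {d : Order.disp_t} {W : orderType d}.
Hypothesis Wwf : well_founded (fun x y : W => x < y).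
Implicit Types (x y z mu kappa : W).

Lemma wf_least (P : set W) : P !=set0 -> exists2 x, P x & forall y, P y -> x <= y.
Proof.
case=> x; elim/(well_founded_ind Wwf): x => x IH Px.
have [[y Py yx]|nP] := pselect (exists2 y, P y & y < x); first exact: IH Py.
exists x => // y Py; rewrite leNgt; apply/negP => yx; apply: nP; by exists y.
Qed.

Lemma below_sub x y : x <= y -> below x `<=` below y.
Proof. by move=> xy z zx; exact: lt_le_trans zx xy. Qed.

Lemma below_card_le x y : x <= y -> below x #<= below y.
Proof. by move=> /below_sub/subset_card_le. Qed.

Lemma below_le_card x T (B : set T) :
  (forall y, y < x -> ~ (B #<= below y)) -> below x #<= B.
Proof.
move=> nB; apply: (wf_card_le Wwf) => [y z _ _|y yx ByE].
  by case: (ltgtP y z); [constructor 2|constructor 3|constructor 1].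
apply: (nB _ yx); apply: (card_le_trans ByE).
by apply: subset_card_le => z [].
Qed.

Lemma below_card_total x T (B : set T) : ~ (below x #<= B) -> B #<= below x.
Proof.
move=> nxB; apply: contrapT => nBx; apply: nxB; apply: below_le_card => y yx.
by move=> /card_le_trans By; apply/nBx/By/below_card_le/ltW.
Qed.

Lemma cardinal_of x :
  exists y, [/\ is_cardinal y, y <= x, below x #<= below y &
                forall z, below x #<= below z -> y <= z].
Proof.
have [|y xy ymin] := @wf_least [set y | below x #<= below y].
  by exists x => /=.
exists y; split=> [z zy||//|z xz].
- apply/card_ltP; split; first exact/below_card_le/ltW.
  by move=> yz; have := ymin _ (card_le_trans xy yz); rewrite leNgt zy.
- exact: ymin (card_lexx _).
- exact: ymin xz.
Qed.

Lemma succ_cardinal_card_le mu nu T (B : set T) : is_succ_cardinal mu nu ->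
  ~ (B #<= below mu) -> below nu #<= B.
Proof.
move=> [_ _ numin] nBmu; apply: below_le_card => y yn By; apply: nBmu.
(* The cardinal of [y] lies below [nu], hence is at most [mu]. *)
have [z [zc zy yz _]] := cardinal_of y.
apply: (card_le_trans By); apply: (card_le_trans yz); apply: below_card_le.
rewrite leNgt; apply/negP => /(numin _ zc); rewrite leNgt => /negP; apply.
exact: le_lt_trans yn.
Qed.

(** Pairs are compared by maximum, then lexicographically, so that the predecessors of a pair lie in
    a square whose side is the successor of its maximum. *)
Definition goedel (p q : W * W) : Prop :=
  Order.max p.1 p.2 < Order.max q.1 q.2 \/
  Order.max p.1 p.2 = Order.max q.1 q.2 /\
    (p.1 < q.1 \/ p.1 = q.1 /\ p.2 < q.2).

Lemma goedel_wf : well_founded goedel.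
Proof.
suff H m x y : Order.max x y = m -> Acc goedel (x, y) by case=> x y; exact: H.
elim/(well_founded_ind Wwf): m x y => m IHm x.
elim/(well_founded_ind Wwf): x => x IHx y.
elim/(well_founded_ind Wwf): y => y IHy mE.
constructor=> -[x' y'] [/=|/= [mE' [|[xE]]]].
- by rewrite mE => lt; exact: IHm lt _ _ erefl.
- by move=> lt; apply: IHx => //; rewrite mE'.
- by move=> lt; rewrite xE; apply: IHy => //; rewrite -xE mE'.
Qed.

Lemma goedel_total p q : [\/ p = q, goedel p q | goedel q p].
Proof.
rewrite /goedel; case: p q => [x y] [x' y'] /=.
have [lt|lt|mE] := ltgtP (Order.max x y) (Order.max x' y').
- by constructor 2; left.
- by constructor 3; left.
have [lt|lt|xE] := ltgtP x x'; last subst x'.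
- by constructor 2; right; split=> //; left.
- by constructor 3; right; split; [exact: esym|left].
have [lt|lt|yE] := ltgtP y y'; last subst y'.
- by constructor 2; right; split=> //; right.
- by constructor 3; right; split; [exact: esym|right].
- by constructor 1.
Qed.

(** Hessenberg's theorem, by induction on [x]. If [x] is equinumerous with a smaller ordinal,
    induction applies to that one; otherwise [goedel] has only initial segments too small to receive
    an injection from [below x]. *)
Lemma below_setX x : infinite_set (below x) -> below x `*` below x #<= below x.
Proof.
elim/(well_founded_ind Wwf): x => x IH infx.
have setX_le T (A : set T) y : A #<= below y ->
    A `*` A #<= below y `*` below y.
  move=> /(card_leP_inj x)[f [fA fI]].
  apply: (@card_le_inj _ _ _ _ (fun p => (f p.1, f p.2))).
    by move=> [a b] [/= Aa Ab]; split; exact: fA.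
  by move=> [a b] [a' b'] [/= ? ?] [/= ? ?] [] /fI-> // /fI->.
have [[y yx xy]|nx] := pselect (exists2 y, y < x & below x #<= below y).
  apply: (card_le_trans (setX_le _ _ _ xy)).
  apply: (card_le_trans (IH _ yx _)).
    by move=> fy; apply/infx/(card_le_finite xy).
  exact/below_card_le/ltW.
apply: (wf_card_le goedel_wf) => [p q _ _|[a b] [/= ax bx] xle].
  exact: goedel_total.
pose m := Order.max a b.
have mx : m < x by rewrite gt_max ax bx.
(* The point [m] is added because coordinates may equal the maximum. *)
have {}xle : below x #<= (below m `|` [set m]) `*` (below m `|` [set m]).
  apply: (card_le_trans xle); apply: subset_card_le => -[a' b'] [_] gp.
  have : Order.max a' b' <= m by case: gp => [/ltW|[->]].
  by rewrite ge_max => /andP[]; rewrite !le_eqVlt => /orP[/eqP->|?] /orP[/eqP->|?];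
     split=> /=; (by left) || (by right).
have [finm|infm] := pselect (finite_set (below m)).
  apply/infx/(card_le_finite xle)/finite_setX;
  by rewrite finite_setU; split=> //; exact: finite_set1.
apply: nx; exists m => //; apply: (card_le_trans xle).
apply: card_le_trans (IH _ mx infm); apply: setX_le.
exact: infinite_setU1_card.
Qed.

Lemma bigcup_card_le x I T (D : set I) (F : I -> set T) :
  infinite_set (below x) -> D #<= below x ->
  (forall i, D i -> F i #<= below x) -> \bigcup_(i in D) F i #<= below x.
Proof.
move=> infx /(card_leP_inj x)[f [fD fI]] Fx; apply: card_le_trans (below_setX infx).
have /choice[g gP] : forall i, exists g : T -> W, D i ->
    (forall t, F i t -> below x (g t)) /\
    (forall t u, F i t -> F i u -> g t = g u -> t = u).
  move=> i; have [Di|nDi] := pselect (D i); last by exists (fun=> x).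
  by have [g gP] := card_leP_inj x (Fx _ Di); exists g.
apply: (@card_le_rel _ _ _ _ (fun t p => exists i, [/\ D i, F i t & p = (f i, g i t)])).
  move=> t [i Di Fit]; exists (f i, g i t); last by exists i.
  by split; [exact: fD|case: (gP _ Di) => + _; apply].
move=> t u p _ _ [i [Di Fit ->]] [j [Dj Fju [fij gtu]]].
have ij := fI _ _ Di Dj fij; subst j.
by have [_] := gP _ Di; apply.
Qed.


(** Through characteristic functions, the two hypotheses say that each requirement [E i] is dense
    and open. The complements of these sets are too few members of [Mkk] to cover the space, and any
    uncovered point yields [C]. *)
Lemma covM_generic kappa I (A : set I) (E : I -> set (set W)) :
  below kappa !=set0 -> A #< covM kappa ->
  (forall i a c, A i -> Psub kappa (below kappa) a -> c `<=` below kappa ->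
    exists c', [/\ c' `<=` below kappa, c' `&` a = c `&` a & E i c']) ->
  (forall i c, A i -> c `<=` below kappa -> E i c ->
    exists2 a, Psub kappa (below kappa) a &
      forall c', c' `<=` below kappa -> c' `&` a = c `&` a -> E i c') ->
  exists2 C, C `<=` below kappa & forall i, A i -> E i C.
Proof.
move=> [k0 k0P] /card_ltP[_ nMA] Ed Eo.
pose supp (f : ktwo kappa) : set W := [set x | exists2 u, val u = x & f u].
pose chi (C : set W) : ktwo kappa := fun u => `[< C (val u) >].
have suppS f : supp f `<=` below kappa.
  by move=> _ [u <- _]; exact: set_valP.
have supp_val f u : supp f (val u) = f u :> Prop.
  by apply/propext; split=> [[v /val_inj->]|fu] //; exists u.
have suppK C : C `<=` below kappa -> supp (chi C) = C.
  move=> Ck; apply/seteqP; split=> [_ [u <- /asboolP]//|x Cx].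
  by exists (SigSub (mem_set (Ck _ Cx))) => //; apply/asboolP.
pose D i : set (ktwo kappa) := [set f | E i (supp f)].
have Dopen i : A i -> kopen (D i).
  move=> Ai; exists [set O | basic_open kappa O /\ O `<=` D i]; first by move=> O [].
  apply/seteqP; split=> [f Df|f [O [_ OD] /OD]//].
  have [a aP aE] := Eo _ _ Ai (@suppS f) Df.
  exists (basicO a f) => //; split; first by right; exists a, f.
  move=> g gf; apply: aE => //; apply/seteqP; split=> x [] [u <- fu] au; split=> //;
    exists u => //; [rewrite -gf|rewrite gf] => //.
have Ddense i : A i -> kdense (D i).
  move=> Ai U [C Cb ->] [f [O CO Of]]; case: (Cb _ CO) Of => [->//|[a [s [aP OE]]]] _.
  have [c [ck ca Ec]] := Ed i a _ Ai aP (@suppS s).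
  exists (chi c); split; first by rewrite /D /= suppK.
  exists O => //; rewrite OE => x ax; apply/idP/idP => [/asboolP cx|sx].
    have [] : (supp s `&` a) (val x) by rewrite -ca.
    by rewrite supp_val.
  by apply/asboolP; have [] : (c `&` a) (val x) by rewrite ca; split; rewrite ?supp_val.
pose Y := (fun i => ~` D i) @` A.
have YM : Y `<=` Mkk kappa.
  move=> _ [i Ai <-]; exists [set D i]; split=> [_ ->|||].
  - by split; [exact: Dopen|exact: Ddense].
  - by exists (D i).
  - by apply: (@card_le_inj _ _ _ _ (fun=> k0)) => // ? ? -> ->.
  - by rewrite bigcap_set1 setICl.
have [f nYf] : exists f, ~ (\bigcup_(V in Y) V) f.
  apply: contrapT => nf; apply: nMA.
  have Ycov : Y `<=` Mkk kappa /\ \bigcup_(V in Y) V = setT.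
    split=> //; apply/seteqP; split=> // f _; apply: contrapT => nYf.
    by apply: nf; exists f.
  have [|_ /(_ _ Ycov) MY] := @min_cardP _
    [set Z | Z `<=` Mkk kappa /\ \bigcup_(V in Z) V = setT]; first by exists Y.
  exact: card_le_trans MY (card_image_le _ _).
exists (supp f) => // i Ai; apply: contrapT => nE; apply: nYf.
by exists (~` D i) => //; exists i.
Qed.

(* Landver: if the subsets of [x] outnumber [kappa], a generic subset of [kappa],
   cut into [kappa] blocks of length [x], must contain [kappa^+] distinct blocks. *)
Lemma covM_powerset kappa kappa_succ x :
  infinite_set (below kappa) -> is_cardinal kappa ->
  is_succ_cardinal kappa kappa_succ -> below kappa_succ #< covM kappa ->
  x < kappa -> [set c | c `<=` below x] #<= below kappa.
Proof.
move=> infk kcard ksucc kM xk; apply: contrapT => npow.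
have [s [sx sI]] := card_leP_inj set0 (succ_cardinal_card_le ksucc npow).
have [e [ek eI]] := card_leP_inj x (below_setX infk).
have {}ek y z : y < kappa -> z < x -> e (y, z) < kappa.
  by move=> yk zx; apply: ek; split=> //=; exact: lt_trans zx xk.
have {}eI y z y' z' : y < kappa -> z < x -> y' < kappa -> z' < x ->
    e (y, z) = e (y', z') -> (y, z) = (y', z').
  by move=> yk zx yk' zx'; apply: eI; split=> //=; exact: lt_trans xk.
pose codes C y i := forall z, z < x -> C (e (y, z)) <-> s i z.
have [| |||C Ck CE] := @covM_generic kappa W (below kappa_succ)
  (fun i => [set C | exists2 y, y < kappa & codes C y i]) => //.
- by exists x.
- move=> i a c iks [ak aklt] ck.
  (* The blocks are disjoint: if [a] met all of them, [kappa] would inject into [a]. *)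
  have [y yk ya] : exists2 y, y < kappa & forall z, z < x -> ~ a (e (y, z)).
    apply: contrapT => ny; move/card_ltP: aklt => [_]; apply.
    apply: (@card_le_rel _ _ _ _ (fun y t => exists2 z, z < x & t = e (y, z))).
      move=> y yk; apply: contrapT => nt; apply: ny; exists y => // z zx aez.
      by apply: nt; exists (e (y, z)) => //; exists z.
    by move=> y y' t yk yk' [z zx ->] [z' zx' /eI]; case/(_ yk zx yk' zx').
  exists (c `&` a `|` [set t | exists2 z, z < x /\ s i z & t = e (y, z)]).
  split.
  + by move=> t [[/ck]//|[z [zx _] ->]]; exact: ek.
  + apply/seteqP; split=> [t [[[]//|[z [zx _] ->]]]|t [ct at_]].
      by move=> /(ya _ zx).
    by split=> //; left.
  + exists y => // z zx; split=> [[[_ /(ya _ zx)]//|]|siz].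
      by move=> [z' [zx' siz'] /eI]; case/(_ yk zx yk zx') => ->.
    by right; exists z.
- move=> i c iks ck [y yk cE]; exists ((fun z => e (y, z)) @` below x).
    split=> [_ [z zx <-]|]; first exact: ek.
    exact: card_le_lt_trans (card_image_le _ _) (kcard _ xk).
  move=> c' ck' cc'; exists y => // z zx; rewrite -cE //.
  have az : ((fun z => e (y, z)) @` below x) (e (y, z)) by exists z.
  split=> cez.
    by have [] : (c `&` (fun z => e (y, z)) @` below x) (e (y, z)) by rewrite -cc'.
  by have [] : (c' `&` (fun z => e (y, z)) @` below x) (e (y, z)) by rewrite cc'.
have [scard kks _] := ksucc.
(* A block codes at most one [i], so sending [i] to a block coding it would inject [kappa_succ] into
   [kappa]. *)
have /card_ltP[_] := scard _ kks; apply.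
apply: (@card_le_rel _ _ _ _ (fun i y => codes C y i)).
  by move=> i /CE.
move=> i j y iks jks iC jC; apply: sI => //; apply/seteqP.
split=> z sz.
- by have zx : z < x := sx _ iks _ sz; apply/(jC _ zx)/(iC _ zx).
- by have zx : z < x := sx _ jks _ sz; apply/(iC _ zx)/(jC _ zx).
Qed.

(** Otherwise [kappa] would be the successor of the cardinal of [x]. *)
Lemma is_limit_cardinal_lt kappa x : is_limit_cardinal kappa -> x < kappa ->
  exists2 y, y < kappa & ~ (below y #<= below x).
Proof.
move=> [kcard klim] xk; apply: contrapT => ny.
have [z [zcard zx xz _]] := cardinal_of x.
apply: (klim _ zcard); split=> // [|y ycard zy]; first exact: le_lt_trans xk.
rewrite leNgt; apply/negP => yk; apply: ny; exists y => // yx.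
have /card_ltP[_] := ycard _ zy; apply; exact: card_le_trans xz.
Qed.

(** Regularity gives a bound below [kappa], and well-foundedness a least one, so the supremum exists
    and the [xget] in [ksup] returns it. *)
Lemma ksupP kappa lambda b : is_regular kappa -> Psub kappa (below lambda) b ->
  ksup kappa b < kappa /\ forall y, y < kappa -> b y -> y <= ksup kappa b.
Proof.
move=> [kcard _ kreg] [_ bk].
have [|x xk bx] := kreg (b `&` below kappa).
  split; first by move=> y [].
  by apply: card_le_lt_trans bk; apply: subset_card_le => y [].
have [|u uub umin] := @wf_least (ubound (b `&` below kappa)).
  by exists x => y /bx/ltW.
have [sub slb] : supremums (b `&` below kappa) (ksup kappa b).
  by apply: (@xgetI _ _ _ u); split.
split; first by apply: le_lt_trans xk; apply: slb => y /bx/ltW.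
by move=> y yk yb; apply: sub.
Qed.

(** * Cofinality and fineness of an ideal on [Psub kappa (below lambda)] *)

Section Ideal.
Variables (kappa lambda : W) (H : set (set (set W))).
Hypothesis Hideal : is_Pkl_ideal kappa lambda H.
Hypothesis kinf : infinite_set (below kappa).

Let Hsub A B : H A -> B `<=` A -> H B.
Proof. by have [[_ _ + _ _] _ _] := Hideal; apply. Qed.

Lemma cofP : cof H `<=` H /\ forall B, H B -> exists2 X, cof H X & B `<=` X.
Proof.
have [|[cH HE] _] := @min_cardP _
    [set X | X `<=` H /\ H = \bigcup_(A in X) [set B | B `<=` A]].
  exists H; split=> //; apply/seteqP; split=> [B HB|B [A HA BA]]; first by exists B.
  exact: Hsub HA BA.
by split=> // B; rewrite {1}HE => -[X cX BX]; exists X.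
Qed.

Lemma Pkl_ideal_avoid x : x < lambda ->
  H [set b | Psub kappa (below lambda) b /\ ~ b x].
Proof.
move=> xl; have [_ _] := Hideal; apply; split; first by move=> b [].
exists [set x]; last by apply/seteqP; split=> [b [[_ bx] [_ /(_ x erefl)]]|].
split; first by move=> _ ->.
apply/card_ltP; split; last by move=> /card_le_finite/(_ (finite_set1 x)).
have [y yk] := infinite_setN0 kinf.
by apply: (@card_le_inj _ _ _ _ (fun=> y)) => // ? ? -> ->.
Qed.

(** Diagonal argument: were there at most [kappa] sets [X] in [cof H], points [f X] chosen outside
    each would have a union of size at most [kappa], missing some [x] below [kappa_succ]. By
    fineness the sets omitting [x] lie inside one [X], which would then contain [f X]. *)
Lemma succ_cardinal_le_cof kappa_succ : is_cardinal lambda -> kappa < lambda ->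
  is_succ_cardinal kappa kappa_succ -> below kappa_succ #<= cof H.
Proof.
move=> lcard kl ksucc; apply: contrapT => nle.
have cofk : cof H #<= below kappa.
  by apply: contrapT => /(succ_cardinal_card_le ksucc).
have [scard kks /(_ _ lcard kl) ksl] := ksucc.
have [cH cofE] := cofP.
have /choice[f fP] X : exists b, cof H X -> Psub kappa (below lambda) b /\ ~ X b.
  have [cX|] := pselect (cof H X); last by exists set0.
  apply: contrapT => nb; have [[_ _ _ _ +] _ _] := Hideal; apply.
  apply: Hsub (cH _ cX) _ => b bP; apply: contrapT => nXb; apply: nb.
  by exists b.
have [x xks nx] : exists2 x, x < kappa_succ & forall X, cof H X -> ~ f X x.
  apply: contrapT => nx; have /card_ltP[_] := scard _ kks; apply.
  apply: (@card_le_trans _ _ _ (\bigcup_(X in cof H) f X)).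
    apply: subset_card_le => x xks; apply: contrapT => nfx; apply: nx.
    by exists x => // X cX fXx; apply: nfx; exists X.
  apply: bigcup_card_le => // X cX.
  by have [[_ /card_ltP[]]] := fP _ cX.
have [X cX XE] := cofE _ (Pkl_ideal_avoid (lt_le_trans xks ksl)).
have [fXP] := fP _ cX; apply; apply: XE; split=> //; exact: nx.
Qed.

(** * Counting the colors avoided almost everywhere *)

Section Colors.
Variables (A : set (set W)) (F : W * set W -> W).
Hypothesis Apos : positive (Psub kappa (below lambda)) H A.

Let avoid c g := [set b | A b /\ forall x, c x -> F (x, b) <> g].

Lemma bad_colors_card_le x c : is_limit_cardinal kappa -> x < kappa ->
  c `<=` below x -> [set g | H (avoid c g)] #<= below kappa.
Proof.
move=> klim xk cx; apply: below_card_total => /(card_leP_inj x)[h [hH hI]].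
(* The first [y] of the [kappa] bad colors are already more numerous than [c], yet few enough for
   [kappa]-completeness. *)
have [y yk nyx] := is_limit_cardinal_lt klim xk.
have yk' := below_sub (ltW yk).
have [_ Hcomp _] := Hideal; have [AS nHA] := Apos.
have HU : H (\bigcup_(Z in (avoid c \o h) @` below y) Z).
  apply: Hcomp => [_ [z zy <-]|]; first exact/hH/yk'.
  apply: card_le_lt_trans (card_image_le _ _) _.
  by have [kcard _] := klim; exact: kcard.
have [b Ab nb] : exists2 b, A b & forall z, z < y -> ~ avoid c (h z) b.
  apply: contrapT => nb; apply/nHA/(Hsub HU) => b Ab; apply: contrapT => nU.
  apply: nb; exists b => // z zy hzb; apply: nU.
  by exists (avoid c (h z)) => //; exists z.
apply: nyx; apply: card_le_trans (subset_card_le cx).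
apply: (@card_le_rel _ _ _ _ (fun z a => F (a, b) = h z)).
  move=> z zy; apply: contrapT => na; apply: (nb _ zy); split=> // a ca Fa.
  by apply: na; exists a.
by move=> z z' a zy zy' -> /hI; apply; exact: yk'.
Qed.

(** At most [kappa] bounded sets, each with at most [kappa] bad colors, cannot exhaust
    [kappa_succ]. *)
Lemma good_color kappa_succ : is_limit_cardinal kappa ->
  is_succ_cardinal kappa kappa_succ ->
  (forall x, x < kappa -> [set c | c `<=` below x] #<= below kappa) ->
  exists2 g, g < kappa_succ &
    forall x c, x < kappa -> c `<=` below x -> ~ H (avoid c g).
Proof.
move=> klim [scard kks _] pow; apply: contrapT => ng.
have /card_ltP[_] := scard _ kks; apply.
pose bounded := \bigcup_(x in below kappa) [set c | c `<=` below x].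
apply: (@card_le_trans _ _ _ (\bigcup_(c in bounded) [set g | H (avoid c g)])).
  apply: subset_card_le => g gks; apply: contrapT => nHg; apply: ng.
  exists g => // x c xk cx Hcg; apply: nHg; exists c => //; by exists x.
apply: bigcup_card_le => // [|c [x xk cx]]; first exact: bigcup_card_le.
exact: bad_colors_card_le cx.
Qed.

End Colors.
End Ideal.
End Ordinals.

(** * A positive set avoiding one color, read off a generic subset of [kappa] *)

Theorem theorem14p1 (d : Order.disp_t) (W : orderType d)
    (Wwf : well_founded (fun x y : W => x < y))
    (kappa lambda kappa_succ : W) (H : set (set (set W))) :
  is_regular kappa -> ~ countable (below kappa) ->
  is_cardinal lambda -> kappa < lambda ->
  is_succ_cardinal kappa kappa_succ ->
  is_limit_cardinal kappa ->
  is_Pkl_ideal kappa lambda H ->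
  cof H #< covM kappa ->
  karrow kappa lambda H kappa_succ.
Proof.
move=> kreg _ lcard kl ksucc klim Hideal HM F _ A Apos.
have [kcard kinf kbd] := kreg; have [AS nHA] := Apos.
have [[_ _ Hsub HU _] _ _] := Hideal.
have kM : below kappa_succ #< covM kappa.
  exact: card_le_lt_trans (succ_cardinal_le_cof Wwf Hideal kinf lcard kl ksucc) HM.
have pow x := covM_powerset Wwf kinf kcard ksucc kM (x := x).
have [g gks gP] := good_color Wwf Hideal kinf F Apos klim ksucc pow.
have [cH cofE] := cofP Hideal.
pose free C b := [/\ A b, C (ksup kappa b) &
  forall x, C x -> x < ksup kappa b -> F (x, b) <> g].
have [|X a c cX [ak aklt] ck|X c cX ck [b [Ab cb bF] nXb]|C Ck CE] :=
    @covM_generic _ W kappa _ (cof H)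
      (fun X => [set C | exists2 b, free C b & ~ X b]) _ HM.
- exact: infinite_setN0.
- have [x xk ax] := kbd a (conj ak aklt).
  (* Density: both [X] and the family of sets omitting [x] belong to [H], so goodness of [g] for [c]
     restricted to [a] leaves a [b] outside both. *)
  have [b [Ab bF] [bx nXb]] : exists2 b,
      A b /\ (forall y, (c `&` a) y -> F (y, b) <> g) & b x /\ ~ X b.
    apply: contrapT => nb; apply: (gP x (c `&` a) xk) => [y [_ /ax]//|].
    apply: (Hsub _ _ (HU _ _ (cH _ cX) (Pkl_ideal_avoid Hideal kinf (lt_trans xk kl)))) => b bP.
    have [Xb|nXb] := pselect (X b); [by left|right].
    split; first by apply: AS; case: bP.
    by move=> bx; apply: nb; exists b.
  have [bk bsup] := ksupP Wwf kreg (AS _ Ab).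
  have xb := bsup _ xk bx.
  (* Since [x] is in [b], the added supremum is at least [x], hence above all of [a]: the trace on
     [a] is unchanged. *)
  exists (c `&` a `|` [set ksup kappa b]); split.
  + by move=> y [[/ck]//|->].
  + apply/seteqP; split=> [y [[[]//|->]] /ax|y ca]; first by rewrite ltNge xb.
    by split; [left|case: ca].
  + exists b => //; split=> // [|y [ca _|->]]; first by right.
      exact: bF.
    by rewrite ltxx.
- have [bk _] := ksupP Wwf kreg (AS _ Ab).
  (* Openness: whether [b] is free depends only on [C] up to and including the supremum of [b], so a
     [y] strictly above it is taken. *)
  have [y yk ny] := is_limit_cardinal_lt Wwf klim bk.
  have by_ : ksup kappa b < y by rewrite ltNge; apply/negP => /below_card_le.
  exists (below y); first by split; [exact/below_sub/ltW|exact: kcard].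
  move=> c' ck' cc'; exists b => //.
  have cy z : z < y -> c' z <-> c z.
    move=> zy; split=> cz.
      by have [] : (c `&` below y) z by rewrite -cc'.
    by have [] : (c' `&` below y) z by rewrite cc'.
  split=> // [|z c'z zb]; first exact/cy.
  by apply: bF => //; apply/cy => //; exact: lt_trans by_.
exists [set b | free C b]; split.
- split; first by move=> b [/AS].
  (* Were this set in [H], some [X] in [cof H] would contain it, against the requirement for [X]. *)
  move=> /cofE[X cX BX]; have [b bfree] := CE _ cX; apply; exact: BX.
- by move=> b [].
- move=> Fks; have : below kappa_succ g by [].
  rewrite -Fks => -[_ [a [b [[_ Ca _] [_ _ bF] ab ->]]]].
  exact: bF.
Qed.
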